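(* Let $R$ be a unital ring with involution and let $a\in R$ be core invertible with core inverse $a^{\mathrm{core}}$. Then $a$ is an EP element if and only if $[a^{\mathrm{core}},(a^{\mathrm{core}}a)^*a]=0$.
   Context: A unital (associative, not necessarily commutative) ring with involution is a unital ring $R$ with a map $a\mapsto a^*$ satisfying $(a^* )^*=a$, $(ab)^*=b^*a^*$, $(a+b)^*=a^*+b^*$ for all $a,b\in R$. Notation: $[a,b]=ab-ba$, $aR=\{ar:r\in R\}$, $Ra=\{ra:r\in R\}$. The Moore-Penrose inverse of $a\in R$ is the element $a^\dagger=x$ (unique if it exists) with $axa=a$, $xax=x$, $(ax)^*=ax$, $(xa)^*=xa$; the group inverse of $a$ is the element $a^\#=x$ (unique if it exists) with $axa=a$, $xax=x$, $ax=xa$. An element $a\in R$ is EP if it is both Moore-Penrose invertible and group invertible and $a^\dagger=a^\#$. The core inverse of $a$ is the element $a^{\mathrm{core}}=x$ (unique if it exists) with $axa=a$, $xR=aR$ and $Rx=Ra^*$; $a$ is core invertible if it exists. *)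

(* Defs.v *)
From mathcomp Require Import all_boot all_algebra.

Set Implicit Arguments.
Unset Strict Implicit.
Unset Printing Implicit Defensive.

Import GRing.Theory.
Local Open Scope ring_scope.

(* Rings are taken as [pzRingType] (not [nzRingType]), so that the zero ring *)
(* is allowed; multiplication is not assumed commutative.                    *)
Record ring_involution (R : pzRingType) (star : R -> R) : Prop :=
  RingInvolution {
    starK : involutive star;
    starM : forall a b : R, star (a * b) = star b * star a;
    starD : forall a b : R, star (a + b) = star a + star b
  }.

Definition bracket (R : pzRingType) (a b : R) : R := a * b - b * a.

Definition in_right_ideal (R : pzRingType) (a z : R) : Prop :=
  exists r : R, z = a * r.

Definition in_left_ideal (R : pzRingType) (a z : R) : Prop :=
  exists r : R, z = r * a.

(* The generalized inverses need not exist, so each is given as a relation   *)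
(* "x is the inverse of a" rather than as a function of a.                   *)
Definition is_MP_inverse (R : pzRingType) (star : R -> R) (a x : R) : Prop :=
  [/\ a * x * a = a, x * a * x = x,
      star (a * x) = a * x & star (x * a) = x * a].

Definition is_group_inverse (R : pzRingType) (a x : R) : Prop :=
  [/\ a * x * a = a, x * a * x = x & a * x = x * a].

Definition is_EP (R : pzRingType) (star : R -> R) (a : R) : Prop :=
  exists x y : R,
    [/\ is_MP_inverse star a x, is_group_inverse a y & x = y].

Definition is_core_inverse (R : pzRingType) (star : R -> R) (a x : R) : Prop :=
  [/\ a * x * a = a,
      forall z : R, in_right_ideal x z <-> in_right_ideal a z
    & forall z : R, in_left_ideal x z <-> in_left_ideal (star a) z].

(* Main.v *)
Require Import Defs.
From mathcomp Require Import all_boot all_algebra.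

Import GRing.Theory.
Local Open Scope ring_scope.

(** Let [x] be the core inverse of [a] and put [p = x a], [q = a x].  These are
    idempotents with the same right ideal [aR], that is [p q = q] and
    [q p = p], and [q] is self-adjoint; [a] is EP exactly when [p = q]
    ([EP_core_comm]).  Taking adjoints of the two relations gives [q p* = q]
    and [p* q = p*].  The bracket of the theorem is therefore [x p* a - p*].
    If it vanishes, then [p*] lies in [xR = qR], so [p* = q p* = q] and
    [p = q].  Conversely, if [p = q] then [p* a = q a = a], and the bracket is
    [p - q = 0]. *)

(** The ideal conditions become equations.  The key one, self-adjointness of
    [a x], comes from [x = s a*]: since [a* = a* (a x)*], this gives
    [x = x (a x)*], and [a x = (a x) (a x)*] is self-adjoint.  The others
    express [x] through [a] and [a] through [x] on the right. *)
Lemma core_inverse_eqs (R : pzRingType) (star : R -> R)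
    (star_inv : ring_involution star) (a x : R) :
  is_core_inverse star a x ->
  [/\ x * a * x = x, star (a * x) = a * x, x * a * a = a & a * x * x = x].
Proof.
case: star_inv => sK sM _ [axa xR Rx].
have [r xE] : in_right_ideal a x by apply/xR; exists 1; rewrite mulr1.
have [u aE] : in_right_ideal x a by apply/xR; exists 1; rewrite mulr1.
have [s xsE] : in_left_ideal (star a) x by apply/Rx; exists 1; rewrite mul1r.
have xq : x = x * star (a * x) by rewrite {1 2}xsE -mulrA -sM axa.
have qH : star (a * x) = a * x.
  have qq : a * x = a * x * star (a * x) by rewrite -mulrA -xq.
  by rewrite {1}qq sM sK -qq.
have xax : x * a * x = x by rewrite -mulrA -qH -xq.
split=> //.
- by rewrite {2 3}aE mulrA xax.
- by rewrite {2 3}xE mulrA axa.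
Qed.

(** For the direct implication, a common Moore-Penrose and group inverse [y] of
    [a] must satisfy [x a = a y = a x]: the first equality holds because
    [a = a a y], the second because a self-adjoint idempotent is determined by
    its right ideal. *)
Lemma EP_core_comm (R : pzRingType) (star : R -> R)
    (star_inv : ring_involution star) (a x : R) :
  is_core_inverse star a x -> is_EP star a <-> x * a = a * x.
Proof.
move=> xP; have [axa _ _] := xP.
have [xax qH xaa axx] := core_inverse_eqs _ _ star_inv _ _ xP.
split=> [[y [z [[aya _ ayH _] [_ _ azC] yz]]]|comm].
  rewrite -yz in azC.
  have xaE : x * a = a * y.
    by rewrite -{1}aya -mulrA -azC !mulrA xaa.
  have [_ sM _] := star_inv.
  by rewrite xaE -[a * y]ayH -{1}axa -mulrA sM ayH qH mulrA aya.
by exists x, x; split; split=> //; rewrite comm.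
Qed.

Theorem theorem3p11 (R : pzRingType) (star : R -> R)
    (star_inv : ring_involution star) (a acore : R)
    (acoreP : is_core_inverse star a acore) :
  is_EP star a <-> bracket acore (star (acore * a) * a) = 0.
Proof.
have [sK sM _] := star_inv; have [axa _ _] := acoreP.
have [xax qH xaa axx] := core_inverse_eqs _ _ star_inv _ _ acoreP.
apply: (iff_trans (EP_core_comm _ _ star_inv _ _ acoreP)); rewrite /bracket.
set x := acore in axa xax qH xaa axx *.
split=> [comm|/eqP]; first by rewrite comm qH axa comm subrr.
have pq : star (x * a) * (a * x) = star (x * a).
  by rewrite -[in LHS]qH -sM mulrA axx.
have qp : a * x * star (x * a) = a * x.
  by rewrite -[in LHS]qH -sM mulrA xaa qH.
rewrite -[star _ * a * x]mulrA pq subr_eq0 => /eqP pE.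
have pHq : star (x * a) = a * x by rewrite -[RHS]qp -pE !mulrA axx.
by rewrite -[x * a]sK pHq qH.
Qed.
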